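(* Let $G(m,n)=\frac{3m^2+m}{2}+2mn+n^2$. Then, as formal power series in $x,q$, \[ \sum_{\pi\in\mathcal{GG}_1}x^{\#(\pi)}q^{|\pi|}=\sum_{m,n\geq0}\frac{x^{m+n}q^{G(m,n)}}{(q;q)_m(q^4;q^4)_{\lfloor n/2\rfloor}},\qquad \sum_{\pi\in\mathcal{GG}_2}x^{\#(\pi)}q^{|\pi|}=\sum_{m,n\geq0}\frac{x^{m+n}q^{G(m,n)+2m+2n}}{(q;q)_m(q^4;q^4)_{\lfloor n/2\rfloor}}. \]
   Context: A partition is a finite non-decreasing sequence $\pi=(\lambda_1,\dots,\lambda_{\#(\pi)})$ of positive integers (the empty sequence is the unique partition of $0$); $\#(\pi)$ is its number of parts and $|\pi|$ the sum of its parts. For $i=1,2$, $\mathcal{GG}_i$ is the set of partitions all of whose parts are $\ge 2i-1$, with $\lambda_j-\lambda_{j-1}\ge2$ for all $j\ge2$ and no two consecutive even parts, i.e. $\lambda_j-\lambda_{j-1}\ge3$ whenever $\lambda_j$ is even. $(a;q)_k=\prod_{i=0}^{k-1}(1-aq^i)$. *)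

(* Defs.v *)
From HB Require Import structures.
From mathcomp Require Import all_boot all_order all_algebra.
From mathcomp Require Import boolp classical_sets cardinality fsbigop.

Set Implicit Arguments.
Unset Strict Implicit.
Unset Printing Implicit Defensive.

Import GRing.Theory.
Local Open Scope ring_scope.

(* R[[t]]: [f n] is the coefficient of t^n. *)
Record fps (R : Type) := FPS { fps_coef :> nat -> R }.
Notation "{ 'fps' R }" := (fps R) (at level 0, format "{ 'fps'  R }").

HB.instance Definition _ (R : Type) := gen_eqMixin (fps R).
HB.instance Definition _ (R : Type) := gen_choiceMixin (fps R).

Lemma fpsP (R : Type) (f g : {fps R}) : f =1 g <-> f = g.
Proof.
by split=> [|-> //]; case: f g => [f] [g] /= /funext ->.
Qed.

Section ComRing.
Variable R : comNzRingType.
Implicit Types f g h : {fps R}.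

Definition fps_zero : {fps R} := FPS (fun=> 0).
Definition fps_opp f : {fps R} := FPS (fun n => - f n).
Definition fps_add f g : {fps R} := FPS (fun n => f n + g n).

Fact fps_addA : associative fps_add.
Proof. by move=> f g h; apply/fpsP => n /=; rewrite addrA. Qed.
Fact fps_addC : commutative fps_add.
Proof. by move=> f g; apply/fpsP => n /=; rewrite addrC. Qed.
Fact fps_add0 : left_id fps_zero fps_add.
Proof. by move=> f; apply/fpsP => n /=; rewrite add0r. Qed.
Fact fps_addN : left_inverse fps_zero fps_opp fps_add.
Proof. by move=> f; apply/fpsP => n /=; rewrite addNr. Qed.

HB.instance Definition _ :=
  GRing.isZmodule.Build (fps R) fps_addA fps_addC fps_add0 fps_addN.

Definition fpsC (c : R) : {fps R} := FPS (fun n => if n == 0%N then c else 0).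
Definition fpsX : {fps R} := FPS (fun n => (n == 1%N)%:R).
Definition fps_mul f g : {fps R} :=
  FPS (fun n => \sum_(i < n.+1) f i * g (n - i)%N).

Lemma fps_mul_coefM (p q : {poly R}) f g n :
    (forall i, (i <= n)%N -> p`_i = f i) ->
    (forall i, (i <= n)%N -> q`_i = g i) ->
  forall i, (i <= n)%N -> (p * q)`_i = fps_mul f g i.
Proof.
move=> pf qg i le_in; rewrite coefM; apply: eq_bigr => j _.
rewrite pf ?qg //; first exact: leq_trans (leq_subr _ _) le_in.
by apply: leq_trans le_in; rewrite -ltnS.
Qed.

Definition fps_trunc f n : {poly R} := \poly_(i < n.+1) f i.

Lemma coef_fps_trunc f n i : (i <= n)%N -> (fps_trunc f n)`_i = f i.
Proof. by move=> le_in; rewrite coef_poly ltnS le_in. Qed.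

Fact fps_mulA : associative fps_mul.
Proof.
move=> f g h; apply/fpsP => n.
have tr := @coef_fps_trunc ^~ n.
rewrite -(fps_mul_coefM (tr f) (fps_mul_coefM (tr g) (tr h)) (leqnn n)).
by rewrite mulrA (fps_mul_coefM (fps_mul_coefM (tr f) (tr g)) (tr h)).
Qed.

Fact fps_mulC : commutative fps_mul.
Proof.
move=> f g; apply/fpsP => n.
have tr := @coef_fps_trunc ^~ n.
by rewrite -(fps_mul_coefM (tr f) (tr g) (leqnn n)) mulrC
  (fps_mul_coefM (tr g) (tr f)).
Qed.

Fact fps_mul1 : left_id (fpsC 1) fps_mul.
Proof.
move=> f; apply/fpsP => n /=.
rewrite big_ord_recl /= mul1r subn0 big1 ?addr0 // => i _.
by rewrite mul0r.
Qed.

Fact fps_mulDl : left_distributive fps_mul fps_add.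
Proof.
move=> f g h; apply/fpsP => n /=; rewrite -big_split /=.
by apply: eq_bigr => i _; rewrite mulrDl.
Qed.

Fact fps_oner_neq0 : fpsC 1 != 0.
Proof. by apply/eqP => /fpsP /(_ 0%N) /eqP; rewrite oner_eq0. Qed.

HB.instance Definition _ := GRing.Zmodule_isComNzRing.Build (fps R)
  fps_mulA fps_mulC fps_mul1 fps_mulDl fps_oner_neq0.

End ComRing.

Arguments fpsX {R}.

Section Inverse.
Variable R : comUnitRingType.
Implicit Types f g : {fps R}.

(* The first n coefficients of 1/f, from the recurrence
   g_0 = f_0^-1,  g_n = - f_0^-1 * \sum_(i < n) f_(n-i) g_i. *)
Fixpoint fps_inv_seq f (n : nat) : seq R :=
  if n is m.+1 then
    let s := fps_inv_seq f m in
    rcons s (if m == 0%N then (f 0%N)^-1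
             else - (f 0%N)^-1 * \sum_(i < m) f (m - i)%N * s`_i)
  else [::].

Definition fps_unit : {pred {fps R}} := [pred f : {fps R} | f 0%N \is a GRing.unit].
Definition fps_inv f : {fps R} :=
  if f \in fps_unit then FPS (fun n => (fps_inv_seq f n.+1)`_n) else f.

Lemma size_fps_inv_seq f n : size (fps_inv_seq f n) = n.
Proof. by elim: n => //= n IHn; rewrite size_rcons IHn. Qed.

Lemma nth_fps_inv_seq f n i :
  (i < n)%N -> (fps_inv_seq f n)`_i = (fps_inv_seq f i.+1)`_i.
Proof.
elim: n => // n IHn; rewrite ltnS leq_eqVlt => /predU1P[-> // | lt_in].
by rewrite -IHn //= nth_rcons size_fps_inv_seq lt_in.
Qed.

Fact fps_mulVf : {in fps_unit, left_inverse 1 fps_inv *%R}.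
Proof.
move=> f Uf; have Uf0 : f 0%N \is a GRing.unit by [].
rewrite /fps_inv Uf; apply/fpsP => n.
change (\sum_(i < n.+1) (fps_inv_seq f i.+1)`_i * f (n - i)%N
        = if n == 0%N then 1 else 0).
rewrite big_ord_recr /= nth_rcons size_fps_inv_seq ltnn eqxx subnn.
case: eqP => [-> | _]; first by rewrite big_ord0 add0r mulVr.
rewrite mulrAC mulNr mulVr // mulN1r; apply/eqP; rewrite subr_eq0; apply/eqP.
by apply: eq_bigr => i _; rewrite (nth_fps_inv_seq f (ltn_ord i)) mulrC.
Qed.

Fact fps_unitPl f g : g * f = 1 -> fps_unit f.
Proof.
move=> /fpsP /(_ 0%N).
change (\sum_(i < 1) g i * f (0 - i)%N = 1 -> fps_unit f).
rewrite big_ord1 => gf1; change (f 0%N \is a GRing.unit).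
by apply/unitrP; exists (g 0%N); split=> //; rewrite mulrC.
Qed.

Fact fps_inv_out : {in [predC fps_unit], fps_inv =1 id}.
Proof. by move=> f /negbTE Uf; rewrite /fps_inv Uf. Qed.

HB.instance Definition _ := GRing.ComNzRing_hasMulInverse.Build (fps R)
  fps_mulVf fps_unitPl fps_inv_out.

End Inverse.

(* Z[[x,q]] as Z[[q]][[x]]: [f k n] is the coefficient of x^k q^n. *)
Definition fps_xq := {fps {fps int}}.
HB.instance Definition _ := GRing.ComUnitRing.on fps_xq.

Definition x : fps_xq := fpsX.
Definition q : fps_xq := fpsC fpsX.

Definition summable (I : choiceType) (A : set I) (F : I -> fps_xq) : Prop :=
  forall k n, finite_set [set i | A i /\ F i k n != 0].

(* Coefficientwise sum, meaningful only for summable families: a coefficient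
   with infinitely many nonzero contributions is set to 0 by the big operator
   of fsbigop. *)
Definition fps_sum (I : choiceType) (A : set I) (F : I -> fps_xq) : fps_xq :=
  FPS (fun k => FPS (fun n => \sum_(i \in A) F i k n)).

Definition qpoch (R : pzRingType) (a b : R) (k : nat) : R :=
  \prod_(0 <= i < k) (1 - a * b ^+ i).

Definition is_partition (pi : seq nat) : bool :=
  all (fun l => 0 < l)%N pi && sorted leq pi.

Definition in_GG (i : nat) (pi : seq nat) : bool :=
  [&& is_partition pi,
      all (fun l => 2 * i - 1 <= l)%N pi,
      sorted (fun l l' => l + 2 <= l')%N pi &
      sorted (fun l l' => ~~ odd l' ==> (l + 3 <= l')%N) pi].

Definition GG (i : nat) : set (seq nat) := [set pi | in_GG i pi]%classic.

(* 3m^2 + m is even, so halving is exact. *)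
Definition G (m n : nat) : nat := ((3 * m ^ 2 + m)./2 + 2 * m * n + n ^ 2)%N.

(* Main.v *)
(* Write F_i for the generating function of GG_i.  Sorting partitions by their
   smallest part gives F_1(x) = F_2(x) + xq F_2(x) + xq^2 F_3(x), where
   F_2(x) = F_1(xq^2) and F_3(x) = F_1(xq^4) because subtracting an even number
   from every part preserves the gap conditions.  Hence the coefficient f_k of
   x^k satisfies (1 - q^(2k)) f_k = q^(2k-1) (1 + q^(2k-1)) f_(k-1).

   On the other side, G(m,n) = (m+n)^2 + m(m+1)/2, so the coefficient of x^k in
   the double sum is q^(k^2) p_k, where p_k is the coefficient of z^k in
   (-zq;q)_oo (1+z)/(z^2;q^4)_oo = (-zq;q^2)_oo/(z;q^2)_oo.  This product P
   satisfies (1-z) P(z) = (1+zq) P(zq^2), which is the same recurrence. *)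

Require Import Defs.
From mathcomp Require Import all_boot all_order all_algebra.
From mathcomp Require Import boolp classical_sets cardinality fsbigop.
From mathcomp Require Import zify ring.

Set Implicit Arguments.
Unset Strict Implicit.
Unset Printing Implicit Defensive.

Import GRing.Theory.
Local Open Scope ring_scope.

(** * Power series: coefficients, units and the substitution z -> cz *)

Section FormalPowerSeries.
Variable R : comNzRingType.
Implicit Types (c : R) (f g : {fps R}).

Lemma coef_fpsD f g n : (f + g) n = f n + g n. Proof. by []. Qed.
Lemma coef_fpsN f n : (- f) n = - f n. Proof. by []. Qed.
Lemma coef_fps1 n : (1 : {fps R}) n = (n == 0%N)%:R. Proof. by case: n. Qed.
Lemma coef_fpsM f g n : (f * g) n = \sum_(i < n.+1) f i * g (n - i)%N.
Proof. by []. Qed.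

Lemma coef_fpsCM c f n : (fpsC c * f) n = c * f n.
Proof.
rewrite coef_fpsM big_ord_recl subn0 big1 ?addr0 // => i _.
by rewrite /= mul0r.
Qed.

Lemma coef_fpsXM f n : (fpsX * f) n = if n is m.+1 then f m else 0.
Proof.
rewrite coef_fpsM big_ord_recl /= mul0r add0r.
case: n => [|n]; first by rewrite big_ord0.
rewrite big_ord_recl /= mul1r subSS subn0 big1 ?addr0 // => i _.
by rewrite mul0r.
Qed.

Lemma coef_fpsXnM f a n :
  (fpsX ^+ a * f) n = if (a <= n)%N then f (n - a)%N else 0.
Proof.
elim: a n => [|a IHa] n; first by rewrite mul1r subn0.
by rewrite exprS -mulrA coef_fpsXM; case: n => // n; rewrite IHa.
Qed.

Lemma fpsCM c d : fpsC (c * d) = fpsC c * fpsC d.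
Proof. by apply/fpsP => n; rewrite coef_fpsCM /=; case: ifP; rewrite ?mulr0. Qed.

Lemma fpsCB c d : fpsC (c - d) = fpsC c - fpsC d.
Proof.
by apply/fpsP => n; rewrite coef_fpsD coef_fpsN /=; case: ifP; rewrite ?subr0.
Qed.

Lemma fpsCX c n : fpsC (c ^+ n) = fpsC c ^+ n.
Proof. by elim: n => // n IHn; rewrite !exprS fpsCM IHn. Qed.

Lemma fpsC_qpoch c d k : fpsC (qpoch c d k) = qpoch (fpsC c) (fpsC d) k.
Proof.
rewrite /qpoch; elim: k => [|k IHk]; first by rewrite !big_nil.
by rewrite !big_nat_recr //= fpsCM IHk fpsCB fpsCM fpsCX.
Qed.

(** The series f(cz). *)
Definition fps_scale c f : {fps R} := FPS (fun n => c ^+ n * f n).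

Lemma coef_fps_scale c f n : fps_scale c f n = c ^+ n * f n. Proof. by []. Qed.

Lemma fps_scaleM c f g : fps_scale c (f * g) = fps_scale c f * fps_scale c g.
Proof.
apply/fpsP => n; rewrite !coef_fpsM /= mulr_sumr; apply: eq_bigr => i _ /=.
by rewrite mulrACA -exprD subnKC // -ltnS.
Qed.

End FormalPowerSeries.

Lemma fpsCV (R : comUnitRingType) (c : R) :
  c \is a GRing.unit -> fpsC c^-1 = (fpsC c)^-1.
Proof.
move=> Uc; have Ufc : fpsC c \is a GRing.unit by [].
by apply: (mulrI Ufc); rewrite mulrV // -fpsCM mulrV.
Qed.

Lemma unit_1BX (R : comUnitRingType) k :
  1 - fpsX ^+ k.+1 \is a @GRing.unit {fps R}.
Proof.
change ((1 - fpsX ^+ k.+1 : {fps R}) 0%N \is a GRing.unit).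
by rewrite coef_fpsD coef_fpsN -[_ ^+ _]mulr1 coef_fpsXnM subr0 unitr1.
Qed.

(** * Euler products and the recurrence for P *)

Lemma qpochS (R : pzRingType) (a b : R) k :
  qpoch a b k.+1 = qpoch a b k * (1 - a * b ^+ k).
Proof. by rewrite /qpoch big_nat_recr. Qed.

Section ProductSeries.
Variables (R : comUnitRingType) (t : R).
Hypothesis unit_1Bt : forall k, 1 - t ^+ k.+1 \is a GRing.unit.

(** The cases j = 0 and j = 3 serve the two factors of the denominator. *)
Lemma unit_qpoch j k : qpoch (t ^+ j.+1) (t ^+ j.+1) k \is a GRing.unit.
Proof.
elim: k => [|k IHk]; first by rewrite /qpoch big_nil unitr1.
rewrite qpochS unitrMl // -exprS -exprM.
exact: unit_1Bt.
Qed.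

Lemma unit_denominator m n :
  qpoch t t m * qpoch (t ^+ 4) (t ^+ 4) n \is a GRing.unit.
Proof. by rewrite unitrM (unit_qpoch 0) (unit_qpoch 3). Qed.

Lemma qpochVS j (a := t ^+ j.+1) k :
  (qpoch a a k.+1)^-1 * (1 - a ^+ k.+1) = (qpoch a a k)^-1.
Proof.
have U i : qpoch a a i \is a GRing.unit := unit_qpoch j i.
by apply: (mulrI (U k)); rewrite mulrCA exprS -qpochS mulVr // mulrV.
Qed.

(* (-zt; t)_oo by Euler's identity. *)
Definition eulerA : {fps R} := FPS (fun m => t ^+ 'C(m.+1, 2) / qpoch t t m).

(* (1 + z) / (z^2; t^4)_oo by Euler's identity. *)
Definition eulerB : {fps R} :=
  FPS (fun n => (qpoch (t ^+ 4) (t ^+ 4) n./2)^-1).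

(** Splits the first factor off (-zt; t)_oo; on exponents this is Pascal's rule for C(m+2, 2). *)
Lemma eulerAE : eulerA = (1 + fpsC t * fpsX) * fps_scale t eulerA.
Proof.
apply/fpsP => n; rewrite mulrDl mul1r coef_fpsD -mulrA coef_fpsCM coef_fpsXM.
case: n => [|m] /=; first by rewrite expr0 mulr0 addr0 mul1r.
have := qpochVS 0 m; rewrite !expr1 => <-.
have -> : 'C(m.+2, 2) = (m.+1 + 'C(m.+1, 2))%N by rewrite binS bin1 addnC.
by rewrite exprD exprS; ring.
Qed.

(** Dilating (1 + z)/(z^2; t^4)_oo by t^2 multiplies it by (1 + t^2 z)(1 - z^2)/(1 + z), and (1 -
    z^2)/(1 + z) = 1 - z. *)
Lemma eulerBE :
  (1 - fpsX) * (1 + fpsC (t ^+ 2) * fpsX) * eulerB = fps_scale (t ^+ 2) eulerB.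
Proof.
set B := eulerB; set c := fpsC _; apply/fpsP => n.
have -> : (1 - fpsX) * (1 + c * fpsX) * B
   = B - fpsX * B + c * (fpsX * B) - c * (fpsX * (fpsX * B)) by ring.
rewrite !(coef_fpsD, coef_fpsN, coef_fpsCM, coef_fpsXM).
case: n => [|[|m]]; rewrite ?coef_fpsXM /=;
  [by rewrite expr0; ring | by rewrite expr1; ring |].
(* Coefficient n depends only on floor(n/2), so the parity of m decides which neighbours agree; both
   cases reduce to [qpochVS] with base t^4. *)
have -> : (t ^+ 2) ^+ m.+2 = (t ^+ 2) ^+ odd m * (t ^+ 4 * (t ^+ 4) ^+ m./2).
  rewrite -!exprM -!exprD; congr (_ ^+ _).
  by rewrite -[in LHS](odd_double_half m) -muln2; ring.
rewrite uphalf_half; case: (odd m); rewrite ?add1n ?add0n;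
  rewrite -(qpochVS 3 m./2) [(t ^+ 4) ^+ m./2.+1]exprS; ring.
Qed.

(** Equals (-zt; t^2)_oo / (z; t^2)_oo, as (z^2; t^4)_oo = (z; t^2)_oo (-z; t^2)_oo. *)
Definition eulerP : {fps R} := eulerA * eulerB.

Lemma eulerPE :
  (1 - fpsX) * eulerP = (1 + fpsC t * fpsX) * fps_scale (t ^+ 2) eulerP.
Proof.
have U : 1 + fpsC (t ^+ 2) * fpsX \is a @GRing.unit {fps R}.
  change ((1 + fpsC (t ^+ 2) * fpsX : {fps R}) 0%N \is a GRing.unit).
  by rewrite coef_fpsD coef_fpsCM mulr0 addr0 unitr1.
(* Two dilations by t make one by t^2, the step at which [eulerBE] works. *)
have A2 : eulerA
    = (1 + fpsC t * fpsX) * (1 + fpsC (t ^+ 2) * fpsX) * fps_scale (t ^+ 2) eulerA.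
  rewrite {1}eulerAE -mulrA; congr (_ * _).
  rewrite {1}eulerAE fps_scaleM; congr (_ * _); apply/fpsP => n.
    rewrite coef_fps_scale !(coef_fpsD, coef_fpsCM).
    by case: n => [|[|n]] /=; ring.
  by rewrite /= mulrA exprAC expr2.
(* The factor 1 + t^2 z occurs in both [A2] and [eulerBE], and cancels because it is a unit. *)
apply: (mulrI U).
by rewrite /eulerP fps_scaleM -eulerBE {1}A2; ring.
Qed.

Lemma eulerP0 : eulerP 0%N = 1.
Proof. by rewrite coef_fpsM big_ord1 /= /qpoch !big_nil !invr1 !mulr1. Qed.

Lemma eulerPS k :
  eulerP k.+1 * (1 - t ^+ (2 * k.+1)) = (1 + t ^+ (2 * k).+1) * eulerP k.
Proof.
move: eulerP eulerPE => P /fpsP/(_ k.+1).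
rewrite !mulrDl !mul1r mulNr -mulrA.
rewrite !(coef_fpsD, coef_fpsN, coef_fpsCM, coef_fpsXM) /= => /eqP.
rewrite subr_eq => /eqP E.
by rewrite [t ^+ (2 * k).+1]exprS !exprM mulrBr mulr1 {1}E; ring.
Qed.

(** Each 1 - t^(2k+2) is a unit, so the recurrence determines f; the extra factor t^(2k+1)
    accumulates to t^(k^2), since (k+1)^2 - k^2 = 2k+1. *)
Lemma eulerP_unique (f : {fps R}) :
    f 0%N = 1 ->
    (forall k, f k.+1 * (1 - t ^+ (2 * k.+1))
       = t ^+ (2 * k).+1 * (1 + t ^+ (2 * k).+1) * f k) ->
  forall k, f k = t ^+ (k ^ 2) * eulerP k.
Proof.
move=> f0 fS; elim=> [|k IHk]; first by rewrite f0 eulerP0 mulr1.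
have U : 1 - t ^+ (2 * k.+1) \is a GRing.unit by rewrite mulnS; exact: unit_1Bt.
apply: (mulIr U); rewrite -mulrA eulerPS fS IHk.
have -> : (k.+1 ^ 2 = (2 * k).+1 + k ^ 2)%N by ring.
by rewrite exprD; ring.
Qed.

Lemma coef_eulerP k : eulerP k =
  \sum_(i < k.+1) t ^+ 'C(i.+1, 2)
    / (qpoch t t i * qpoch (t ^+ 4) (t ^+ 4) (k - i)./2).
Proof.
have Up i : qpoch t t i \is a GRing.unit := unit_qpoch 0 i.
by apply: eq_bigr => i _ /=; rewrite invrM ?Up ?unit_qpoch // mulrA mulrAC.
Qed.

End ProductSeries.

(** * Generating functions of sets of sequences, by length and sum *)

Lemma coef_xq a b (f : fps_xq) k n :
  (x ^+ a * q ^+ b * f) k n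
    = if (a <= k)%N && (b <= n)%N then f (k - a)%N (n - b)%N else 0.
Proof.
rewrite -mulrA coef_fpsXnM; case: leqP => // _.
by rewrite /q -fpsCX coef_fpsCM coef_fpsXnM.
Qed.

Lemma coef_monomial a b k n :
  (x ^+ a * q ^+ b) k n = ((a == k) && (b == n))%:R.
Proof.
rewrite -[_ * _]mulr1 coef_xq coef_fps1 subn_eq0 (eqn_leq a) (eqn_leq b).
case: (leqP a k) => //= _; case: (leqP b n) => [_ | _]; rewrite ?andbF //=.
by case: (k <= a)%N; rewrite // mulr1n coef_fps1 subn_eq0.
Qed.

Lemma coef_scale_qX d (f : fps_xq) k n :
  fps_scale (fpsX ^+ d) f k n = if (d * k <= n)%N then f k (n - d * k)%N else 0.
Proof. by rewrite coef_fps_scale -exprM coef_fpsXnM. Qed.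

Definition weight (pi : seq nat) : fps_xq := x ^+ size pi * q ^+ sumn pi.

Definition of_type k n : set (seq nat) :=
  [set pi | size pi = k /\ sumn pi = n]%classic.

(** Entries are bounded by the sum n, so these sequences come from k-tuples over {0, ..., n}. *)
Lemma finite_of_type k n : finite_set (of_type k n).
Proof.
pose h (t : k.-tuple 'I_n.+1) : seq nat := map val t.
apply: (@sub_finite_set _ _ (h @` setT)%classic).
  move=> pi [/= size_pi sum_pi].
  have le_n i : i \in pi -> (i < n.+1)%N.
    move=> pi_i; rewrite ltnS -sum_pi sumnE (big_rem i) //=; exact: leq_addr.
  have sz : size (pmap (insub : nat -> option 'I_n.+1) pi) = k.
    by rewrite -size_pi size_pmap_sub; apply/eqP; rewrite -all_count; apply/allP.
  exists (Tuple (introT eqP sz)) => //=.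
  rewrite /h /= (pmap_filter (insubK _)) (eq_filter (isSome_insub _)).
  by apply/all_filterP/allP.
exact/finite_image/finite_finset.
Qed.

Lemma summable_weight A : summable A weight.
Proof.
move=> k n; apply: sub_finite_set (finite_of_type k n) => pi [_].
by rewrite coef_monomial; case: andP => // -[/eqP ? /eqP ?]; split.
Qed.

Definition gf (A : set (seq nat)) : fps_xq := fps_sum A weight.

(** Coefficients count sequences, so identities between generating functions reduce to
    bijections. *)
Lemma coef_gf A k n :
  gf A k n = \sum_(pi \in (A `&` of_type k n)%classic) (1 : int).
Proof.
transitivity (\sum_(pi \in (A `&` of_type k n)%classic) weight pi k n).
  symmetry; apply: fsbig_widen => [pi []//|pi [Api /= nt]].
  rewrite coef_monomial; case: andP => // -[/eqP ek /eqP en].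
  by case: nt.
apply: eq_fsbigr => pi; rewrite inE => -[_ [sz sm]].
by rewrite coef_monomial sz sm !eqxx.
Qed.

Lemma gfU A B :
  (A `&` B `<=` set0)%classic -> gf (A `|` B)%classic = gf A + gf B.
Proof.
move=> AB0; apply/fpsP => k; apply/fpsP => n.
rewrite !coef_fpsD !coef_gf setIUl fsbigU0 //.
- exact: finite_setIr (finite_of_type k n).
- exact: finite_setIr (finite_of_type k n).
- by move=> pi [[Api _] [Bpi _]]; exact: AB0.
Qed.

Lemma sum1_image (I J : choiceType) (h : I -> J) (A : set I) (B : set J) :
  injective h -> B = (h @` A)%classic ->
  \sum_(j \in B) (1 : int) = \sum_(i \in A) (1 : int).
Proof. by move=> h_inj ->; apply: fsbig_image => i j _ _; exact: h_inj. Qed.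

Lemma gf_cons a A : gf (cons a @` A)%classic = x * (q ^+ a * gf A).
Proof.
apply/fpsP => k; apply/fpsP => n.
rewrite mulrA -[x]expr1 coef_xq; case: ifP => [/andP[k0 an]|nle]; last first.
  rewrite coef_gf fsbig1 // => _ [[pi _ <-] [/= ek en]].
  by rewrite -ek -en leq_addr in nle.
rewrite !coef_gf; apply: (sum1_image (h := cons a)) => [? ? []//|].
apply/seteqP; split=> [_ [[pi Api <-] [/= <- <-]]|_ [pi [Api [ek en]] <-]].
  by exists pi => //; rewrite subn1 addKn.
by split; [exists pi | rewrite /of_type /= ek en subnKC // subn1 prednK].
Qed.

Lemma sumn_map_addn d pi : sumn (map (addn d) pi) = (d * size pi + sumn pi)%N.
Proof. by elim: pi => [|a pi /= ->]; rewrite ?muln0 ?mulnS //; lia. Qed.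

(** Adding d to each of k parts raises the sum by dk, which is the substitution x -> x q^d. *)
Lemma gf_shift d A :
  gf (map (addn d) @` A)%classic = fps_scale (fpsX ^+ d) (gf A).
Proof.
apply/fpsP => k; apply/fpsP => n.
rewrite coef_scale_qX; case: ifP => [le|nle]; last first.
  rewrite coef_gf fsbig1 // => _ [[pi _ <-] [/= ek en]].
  by rewrite -ek -en size_map sumn_map_addn leq_addr in nle.
rewrite !coef_gf; apply: (sum1_image (inj_map (@addnI d))).
apply/seteqP; split=> [_ [[pi Api <-] []]|_ [pi [Api [ek en]] <-]].
  rewrite size_map sumn_map_addn => ek en.
  by exists pi => //; split=> //; split=> //; rewrite -en -ek addKn.
by split; [exists pi | rewrite /of_type /= size_map sumn_map_addn ek en subnKC].
Qed.

Lemma gf_coef0 A : A [::] -> gf A 0%N = 1.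
Proof.
move=> A0; apply/fpsP => n; rewrite coef_gf coef_fps1.
case: n => [|n]; last by rewrite fsbig1 // => pi [_ [/size0nil ->]].
rewrite (_ : _ `&` _ = [set [::]])%classic ?fsbig_set1 //.
by apply/seteqP; split=> [pi [_ [/size0nil ->]] | _ ->].
Qed.

(** * Gap conditions and the decomposition by smallest part *)

(** Merging both gap conditions gives a transitive relation, so the first part can be compared with
    every later one. *)
Definition gap : rel nat :=
  [rel l l' | (l + 2 <= l')%N && (~~ odd l' ==> (l + 3 <= l')%N)].

Lemma gap_trans : transitive gap.
Proof.
move=> b a c /= /andP[ab _] /andP[bc _].
by apply/andP; split; [lia | apply/implyP; lia].
Qed.

Lemma in_GGE i pi :
  in_GG i.+1 pi = all (leq (2 * i).+1) pi && sorted gap pi.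
Proof.
rewrite /in_GG /is_partition sorted_relI.
have -> : (2 * i.+1 - 1 = (2 * i).+1)%N by lia.
apply/idP/idP => [/and4P[_ -> -> ->] // | /and3P[ge s2 s3]].
rewrite ge s2 s3 !andbT; apply/andP; split.
  by apply: sub_all ge => l; lia.
by apply: sub_sorted s2 => l l'; lia.
Qed.

Lemma in_GG_shift d pi : in_GG d.+1 (map (addn (2 * d)) pi) = in_GG 1 pi.
Proof.
rewrite !in_GGE all_map sorted_map; congr andb.
  by apply: eq_all => l /=; lia.
by apply: eq_sorted => l l'; rewrite /gap /= oddD oddM -!addnA !leq_add2l.
Qed.

Lemma GG_shift d : GG d.+1 = (map (addn (2 * d)) @` GG 1)%classic.
Proof.
apply/seteqP; split=> [pi GGpi | _ [pi + <-]]; last by rewrite /GG /= in_GG_shift.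
(* Truncated subtraction is exact here, all parts being at least 2d + 1. *)
have pi_eq : map (addn (2 * d)) (map (subn^~ (2 * d)%N) pi) = pi.
  rewrite -map_comp map_id_in // => l l_pi /=; rewrite subnKC //.
  by move: GGpi; rewrite /GG /= in_GGE => /andP[/allP/(_ l l_pi)/ltnW].
by exists (map (subn^~ (2 * d)%N) pi); rewrite // /GG /= -(in_GG_shift d) pi_eq.
Qed.

(* 4 cannot follow 2, hence the jump from 3 to 5 in the bound on the tail. *)
Lemma in_GG_cons a pi : (0 < a <= 2)%N -> in_GG 1 (a :: pi) = in_GG a.+1 pi.
Proof.
move=> a12; rewrite !in_GGE /= (path_sortedE gap_trans) andbA; congr andb.
rewrite -andbA -all_predI; have [-> _] := andP a12.
apply: eq_all => l; rewrite /gap /=.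
have [->|->] : a = 1%N \/ a = 2%N by lia.
  by case: l => [|[|[|[|l]]]] //=; rewrite ?implybT.
by case: l => [|[|[|[|[|l]]]]] //=; rewrite ?implybT.
Qed.

Lemma GG1_split :
  GG 1 = (GG 2 `|` (cons 1%N @` GG 2 `|` cons 2%N @` GG 3))%classic.
Proof.
apply/seteqP; split=> pi; rewrite /GG /= !in_GGE; last first.
  case=> [/andP[ge3 ->]|].
    by rewrite andbT; apply: sub_all ge3 => l; lia.
  by case=> -[pi' + <-]; rewrite -in_GGE in_GG_cons.
case: pi => [|a pi]; first by left.
have [->|a1] := eqVneq a 1%N.
  by rewrite -in_GGE in_GG_cons // => ?; right; left; exists pi.
have [->|a2] := eqVneq a 2%N.
  by rewrite -in_GGE in_GG_cons // => ?; right; right; exists pi.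
(* The smallest part is now at least 3, hence so are all parts. *)
move=> /= /andP[/andP[a_gt0 _] gap_pi]; left; rewrite gap_pi andbT.
have a_ge3 : (2 < a)%N by lia.
rewrite a_ge3; move: gap_pi; rewrite (path_sortedE gap_trans) => /andP[+ _].
by apply: sub_all => l /= /andP[]; lia.
Qed.

Lemma gf_GG i : gf (GG i.+1) = fps_scale (fpsX ^+ (2 * i)) (gf (GG 1)).
Proof. by rewrite GG_shift gf_shift. Qed.

Lemma gf_GG1 : gf (GG 1) =
  gf (GG 2) + (x * (q * gf (GG 2)) + x * (q ^+ 2 * gf (GG 3))).
Proof.
rewrite {1}GG1_split !gfU ?gf_cons ?expr1 //.
- by move=> _ [[pi _ <-] [pi' _]].
- by move=> pi [+ [] [pi' _ epi]]; rewrite -epi /GG /= in_GGE.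
Qed.

Lemma gf_GG1_coef k :
  gf (GG 1) k = fpsX ^+ (k ^ 2) * eulerP fpsX k.
Proof.
apply: eulerP_unique => [j| |{}k]; last 1 first.
- have coef_xqX c (f : fps_xq) : (x * (fpsC c * f)) k.+1 = c * f k.
    by rewrite coef_fpsXM coef_fpsCM.
  (* The coefficient of x^(k+1) gives f_(k+1) = q^(2k+2) f_(k+1) + (q q^(2k) + q^2 q^(4k)) f_k. *)
  have := gf_GG1; rewrite (gf_GG 1) (gf_GG 2) /q -fpsCX.
  move: (gf (GG 1)) => g /fpsP/(_ k.+1); rewrite 2!coef_fpsD.
  rewrite [X in _ + (X + _)]coef_xqX [X in _ + (_ + X)]coef_xqX.
  rewrite !coef_fps_scale => /eqP.
  rewrite addrC -subr_eq muln1 -exprM => /eqP E.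
  by rewrite mulrBr mulr1 [X in _ - X]mulrC E [_ ^+ (2 * k).+1]exprS !exprM
    (exprAC (fpsX ^+ 2) 2 k); ring.
- exact: unit_1BX.
- exact: gf_coef0.
Qed.

(** * The double sums, regrouped by powers of x *)

(** The exponent of q is left as a parameter so that one argument serves both identities. *)
Definition double_term (e : nat -> nat -> nat) (mn : nat * nat) : fps_xq :=
  let: (m, n) := mn in
  x ^+ (m + n) * q ^+ e m n / (qpoch q q m * qpoch (q ^+ 4) (q ^+ 4) n./2).

Definition qfraction (R : comUnitRingType) (t : R) (e m n : nat) : R :=
  t ^+ e / (qpoch t t m * qpoch (t ^+ 4) (t ^+ 4) n./2).

(** The denominator is a unit of Z[[q]], so its inverse can be taken there before embedding into
    Z[[q]][[x]]. *)
Lemma double_termE e m n :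
  double_term e (m, n) = x ^+ (m + n) * fpsC (qfraction fpsX (e m n) m n).
Proof.
have U := unit_denominator (@unit_1BX int) m n./2.
rewrite /double_term /qfraction /q -mulrA -fpsCX -!fpsCX -!fpsC_qpoch -fpsCM.
by rewrite -(fpsCV U) -fpsCM.
Qed.

Lemma coef_double_term e k mn :
  double_term e mn k
    = if (mn.1 + mn.2)%N == k then qfraction fpsX (e mn.1 mn.2) mn.1 mn.2 else 0.
Proof.
case: mn => m n; rewrite double_termE coef_fpsXnM /= subn_eq0 eqn_leq.
by case: leqP.
Qed.

Definition antidiag k : set (nat * nat) := [set mn | (mn.1 + mn.2)%N = k]%classic.

Lemma antidiagE k : antidiag k = ((fun i => (i, k - i)%N) @` `I_k.+1)%classic.
Proof.
apply/seteqP; split=> [[m n] /= <- | _ [i /= ik <-]].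
  by exists m; rewrite /= ?ltnS ?leq_addr // addKn.
by rewrite /antidiag /= subnKC.
Qed.

(** Only the finitely many pairs with m + n = k contribute to x^k, whatever the exponent of q. *)
Lemma summable_double_term e : summable setT (double_term e).
Proof.
move=> k n; have : finite_set (antidiag k).
  by rewrite antidiagE; exact/finite_image/finite_II.
apply: sub_finite_set => mn [_].
by rewrite coef_double_term; case: (_ =P k).
Qed.

Lemma coef_sum_double_term e k :
  fps_sum setT (double_term e) k
    = \sum_(i < k.+1) qfraction fpsX (e i (k - i)%N) i (k - i).
Proof.
apply/fpsP => n.
rewrite (big_morph (fun f : {fps int} => f n) (fun _ _ => erefl) erefl).
rewrite (fsbig_ord _ k.+1 (fun i => qfraction fpsX (e i (k - i)%N) i (k - i) n)).
transitivity (\sum_(mn \in antidiag k) double_term e mn k n).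
  symmetry; apply: fsbig_widen => // mn [_ /= nk].
  by rewrite coef_double_term; case: eqP.
rewrite antidiagE fsbig_image => [|i j _ _ [] //].
apply: eq_fsbigr => i; rewrite inE coef_double_term /= ltnS => ik.
by rewrite subnKC // eqxx.
Qed.

Lemma G_E m n : G m n = ((m + n) ^ 2 + 'C(m.+1, 2))%N.
Proof.
(* Halving distributes over this sum because one summand is visibly even. *)
have h : (3 * m ^ 2 + m = m.+1 * m + (m ^ 2).*2)%N by rewrite -muln2; ring.
rewrite /G bin2 h halfD odd_double andbF add0n doubleK; ring.
Qed.

(** The shift by 2i multiplies the coefficient of x^k by q^(2ik), and k = m + n in every
    contributing term. *)
Lemma gf_GG_double_sum i :
  gf (GG i.+1)
    = fps_sum setT (double_term (fun m n => G m n + 2 * i * (m + n))%N).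
Proof.
rewrite gf_GG; apply/fpsP => k; rewrite coef_sum_double_term coef_fps_scale.
rewrite gf_GG1_coef (coef_eulerP (unit_1BX _)) !mulr_sumr.
apply: eq_bigr => j _; rewrite /qfraction !mulrA; congr (_ / _).
rewrite -exprM -!exprD G_E; congr (_ ^+ _).
have le_jk : (j <= k)%N by rewrite -ltnS.
by rewrite subnKC //; lia.
Qed.

Theorem theorem3p3 :
  let w (pi : seq nat) : fps_xq := x ^+ size pi * q ^+ sumn pi in
  let t1 (mn : nat * nat) : fps_xq :=
    let: (m, n) := mn in
    x ^+ (m + n) * q ^+ G m n
      / (qpoch q q m * qpoch (q ^+ 4) (q ^+ 4) n./2) in
  let t2 (mn : nat * nat) : fps_xq :=
    let: (m, n) := mn in
    x ^+ (m + n) * q ^+ (G m n + 2 * m + 2 * n)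
      / (qpoch q q m * qpoch (q ^+ 4) (q ^+ 4) n./2) in
  [/\ summable (GG 1) w, summable setT t1
    & fps_sum (GG 1) w = fps_sum setT t1]
  /\
  [/\ summable (GG 2) w, summable setT t2
    & fps_sum (GG 2) w = fps_sum setT t2].
Proof.
move=> w t1 t2.
(* The two identities are the cases i = 0 and i = 1 of [gf_GG_double_sum]. *)
have -> : t1 = double_term (fun m n => G m n + 2 * 0 * (m + n))%N.
  by apply/funext => -[m n]; rewrite /double_term addn0.
have -> : t2 = double_term (fun m n => G m n + 2 * 1 * (m + n))%N.
  by apply/funext => -[m n]; rewrite /double_term muln1 mulnDr addnA.
split; split; try exact: summable_weight; try exact: summable_double_term;
  exact: gf_GG_double_sum.
Qed.
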